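(* Let $n\ge 1$, let $X\subset\mathbb{R}^n$ be a finite set, let $F$ be a Finsler metric on $\mathbb{R}^n$, and let $\{\Delta_\varepsilon\}_{\varepsilon>0}$, $\Delta_\varepsilon=\check{C}ech(X,\varepsilon)$, be the Čech filtration of $X$ induced by $F$. Then, for any field $\Bbbk$, \[ H_k(\Delta_\varepsilon;\Bbbk)=0\quad\text{for all }\varepsilon>0\text{ and all }k>n. \] In particular, the $k$-th persistent homology module $\varepsilon\mapsto H_k(\Delta_\varepsilon;\Bbbk)$ (with the maps induced by the inclusions $\Delta_\varepsilon\hookrightarrow\Delta_{\varepsilon'}$, $\varepsilon\le\varepsilon'$) is trivial for all $k>n$.
   Context: A Finsler metric on $\mathbb{R}^n$ is a function $F:T\mathbb{R}^n=\mathbb{R}^n\times\mathbb{R}^n\to[0,\infty)$ such that, writing $F_x:=F(x,\cdot)$: (1) $F$ is $C^\infty$ on $T\mathbb{R}^n$ minus the zero section; (2) $F(x,\lambda v)=\lambda F(x,v)$ for all $\lambda>0$; (3) for every $x$, the function $F_x^2$ has positive-definite Hessian with respect to $v$ at every $v\neq 0$. $F$ need not be symmetric in $v$. For $\varepsilon>0$ and $p\in\mathbb{R}^n$, the ball of radius $\varepsilon$ centred at $p$ is $\mathcal{B}_\varepsilon(p)=\{x\in\mathbb{R}^n: F_p(x-p)\le\varepsilon\}$, i.e. it is measured with the norm $F_p$ at its centre $p$; it is a convex set. For a finite set $X\subset\mathbb{R}^n$, $\check{C}ech(X,\varepsilon)$ is the abstract simplicial complex with vertex set $X$ in which $\{p_1,\dots,p_{j+1}\}\subset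 X$ spans a $j$-simplex if and only if $\mathcal{B}_\varepsilon(p_1)\cap\cdots\cap\mathcal{B}_\varepsilon(p_{j+1})\neq\emptyset$. $H_k(\cdot;\Bbbk)$ denotes simplicial homology with coefficients in $\Bbbk$. *)

(* Defs.v *)
From HB Require Import structures.
From mathcomp Require Import all_boot all_order all_algebra.
From mathcomp Require Import finmap generic_quotient ring_quotient.
From mathcomp Require Import all_classical all_reals interval_inference.
From mathcomp Require Import topology normedtype derive.

Set Implicit Arguments.
Unset Strict Implicit.
Unset Printing Implicit Defensive.

Import Order.TTheory GRing.Theory Num.Theory.
Import numFieldNormedType.Exports.

Local Open Scope ring_scope.

(* [f] is of class C^k on the open set [U].  In finite dimension, continuity of
   the differential amounts to continuity of every directional derivative. *)
Fixpoint Ck_on (R : realType) (V : normedModType R) (k : nat) (U : set V)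
    (f : V -> R) : Prop :=
  if k is k'.+1 then
    (forall x, U x -> differentiable f x) /\
    (forall v, Ck_on k' U (fun x => 'D_v f x))
  else forall x, U x -> {for x, continuous f}.

Definition smooth_on (R : realType) (V : normedModType R) (U : set V)
    (f : V -> R) : Prop :=
  forall k, Ck_on k U f.

Definition hessian (R : realType) (n : nat) (f : 'rV[R]_n -> R)
    (v : 'rV[R]_n) : 'M[R]_n :=
  \matrix_(i, j) 'D_(delta_mx 0 i) (fun u => 'D_(delta_mx 0 j) f u) v.

Definition posdefmx (R : realType) (n : nat) (A : 'M[R]_n) : Prop :=
  forall w : 'rV[R]_n, w != 0 -> 0 < (w *m A *m w^T) 0 0.

Record finsler (R : realType) (n : nat) := Finsler {
  finsler_fun :> 'rV[R]_n -> 'rV[R]_n -> R;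
  finsler_ge0 : forall x v, 0 <= finsler_fun x v;
  finsler_smooth :
    smooth_on [set xv : 'rV[R]_n * 'rV[R]_n | xv.2 != 0]%classic
              (fun xv => finsler_fun xv.1 xv.2);
  finsler_homogeneous : forall x v (l : R), 0 < l ->
    finsler_fun x (l *: v) = l * finsler_fun x v;
  finsler_posdef : forall x v, v != 0 ->
    posdefmx (hessian (fun u => finsler_fun x u ^+ 2) v) }.

Definition finsler_ball (R : realType) (n : nat) (F : finsler R n) (e : R)
    (p : 'rV[R]_n) : set 'rV[R]_n :=
  [set x | F p (x - p) <= e]%classic.

Lemma finsler0 (R : realType) (n : nat) (F : finsler R n) x : F x 0 = 0.
Proof.
have := finsler_homogeneous F x 0 (ltr0Sn R 1); rewrite scaler0 => h.
apply/eqP; rewrite -(inj_eq (addrI (F x 0))) addr0.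
by rewrite -mulr2n -mulr_natl -h.
Qed.

(* Below, [set0] and the like refer to finite sets. *)
Import mathcomp.boot.finset.
Local Open Scope set_scope.
Local Open Scope ring_scope.

Record scomplex (T : finType) := SComplex {
  simplices :> {set {set T}};
  simplex_neq0 : set0 \notin simplices;
  simplex_vertex : forall x : T, [set x] \in simplices;
  simplex_face : forall s t : {set T},
    s \in simplices -> t \subset s -> t != set0 -> t \in simplices }.

Section Chains.
Variables (K : fieldType) (T : finType).

(* A chain is a [K]-valued function on the subsets of [T]; the chains of a given
   complex in a given degree form the subspace [chains] below, so that the chain
   map induced by an inclusion of complexes is the identity. *)
Definition chain := {ffun {set T} -> K^o}.

Definition basis_chain (s : {set T}) : chain :=
  [ffun t => if t == s then 1 else 0].

(* The position of [v] in [s], its vertices being listed in the order of the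
   enumeration of [T]; another order gives isomorphic homology. *)
Definition vertex_pos (s : {set T}) (v : T) : nat :=
  #|[set u in s | (enum_rank u < enum_rank v)%N]|.

(* The condition [s :\ v != set0] makes the boundary of a vertex zero. *)
Definition simplex_boundary (s : {set T}) : chain :=
  \sum_(v in s | s :\ v != set0)
    (-1) ^+ vertex_pos s v *: basis_chain (s :\ v).

Definition boundary_fun (c : chain) : chain :=
  \sum_(s : {set T}) c s *: simplex_boundary s.

Lemma boundary_fun_is_linear : linear boundary_fun.
Proof.
move=> a c d; rewrite /boundary_fun scaler_sumr -big_split /=.
by apply: eq_bigr => s _; rewrite !ffunE scalerDl scalerA.
Qed.

HB.instance Definition _ :=
  GRing.isLinear.Build K chain chain *:%R boundary_fun boundary_fun_is_linear.

Definition boundary : 'End(chain) := linfun boundary_fun.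

Lemma boundaryE c : boundary c = boundary_fun c.
Proof. by rewrite /boundary lfunE. Qed.

Lemma boundary_basis s : boundary (basis_chain s) = simplex_boundary s.
Proof.
rewrite boundaryE /boundary_fun (bigD1 s) //= ffunE eqxx scale1r.
by rewrite big1 ?addr0 // => t /negPf ts; rewrite ffunE ts scale0r.
Qed.

Lemma chain_basis (c : chain) : c = \sum_s c s *: basis_chain s.
Proof.
apply/ffunP => t; rewrite sum_ffunE (bigD1 t) //= !ffunE eqxx.
rewrite big1 ?addr0 => [|s /negPf st]; first by rewrite /GRing.scale /= mulr1.
by rewrite !ffunE eq_sym st /GRing.scale /= mulr0.
Qed.

Lemma vertex_posD1 (s : {set T}) u v : v \in s ->
  (vertex_pos (s :\ v) u + (enum_rank v < enum_rank u))%N = vertex_pos s u.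
Proof.
move=> vs; rewrite /vertex_pos [in RHS](cardsD1 v) inE vs /= addnC; congr addn.
by apply: eq_card => w; rewrite !inE andbA.
Qed.

Lemma boundary_boundary c : boundary (boundary c) = 0.
Proof.
rewrite [in LHS](chain_basis c); rewrite !linear_sum big1 // => s _.
rewrite !linearZ /= boundary_basis.
suff -> : boundary (simplex_boundary s) = 0 by rewrite scaler0.
rewrite linear_sum /=.
pose term v w : chain := (-1) ^+ (vertex_pos s v + vertex_pos (s :\ v) w) *:
  basis_chain (s :\ v :\ w).
pose P v w := [&& v \in s, w \in s, v != w & s :\ v :\ w != set0].
have -> : \sum_(v in s | s :\ v != set0)
    boundary ((-1) ^+ vertex_pos s v *: basis_chain (s :\ v)) =
    \sum_v \sum_(w | P v w) term v w.
  rewrite big_mkcond; apply: eq_bigr => v _.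
  case: ifPn => [/andP[vs sv]|].
    rewrite linearZ /= boundary_basis scaler_sumr; apply: eq_big => w.
      by rewrite /P vs /= !inE eq_sym andbA [(w \in s) && _]andbC.
    by move=> _; rewrite scalerA -exprD.
  rewrite negb_and negbK => h; rewrite big1 // => w /and4P[vs ws vw].
  case/orP: h => [|/eqP ->]; first by rewrite vs.
  by rewrite set0D eqxx.
have PC v w : P v w = P w v.
  by rewrite /P eq_sym !setDDl setUC; case: (v \in s); case: (w \in s).
have termC v w : P v w -> (enum_rank v < enum_rank w)%N ->
    term v w = - term w v.
  move=> /and4P[vs ws vw _] lt.
  rewrite /term -(vertex_posD1 w vs) -(vertex_posD1 v ws) lt.
  rewrite [(enum_rank w < _)%N]ltnNge (ltnW lt) addn0 addn1 addSn exprS.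
  rewrite mulN1r scaleNr opprK addnC.
  by rewrite !setDDl setUC.
rewrite pair_big_dep /= (bigID (fun p : T * T => (enum_rank p.1 < enum_rank p.2)%N)).
rewrite /= addrC; apply/eqP; rewrite addr_eq0; apply/eqP.
have swap_inj : injective (fun p : T * T => (p.2, p.1)).
  by case=> [a b] [a' b'] /= [-> ->].
rewrite (reindex_inj swap_inj) /=.
rewrite -sumrN; apply: eq_big => -[v w] /=.
  rewrite PC; case: (boolP (P v w)) => //= /and4P[_ _ vw _].
  rewrite -leqNgt ltn_neqAle; case: eqP => // /val_inj /enum_rank_inj vw'.
  by rewrite vw' eqxx in vw.
rewrite PC => /andP[Pvw]; rewrite -leqNgt leq_eqVlt => /orP[/eqP|lt].
  by move=> /val_inj /enum_rank_inj vw; move: Pvw; rewrite /P vw eqxx !andbF.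
by rewrite [term v w]termC ?opprK.
Qed.

Variable D : scomplex T.

Definition chains (k : nat) : {vspace chain} :=
  (\sum_(s in simplices D | #|s| == k.+1) <[basis_chain s]>)%VS.

Definition cycles (k : nat) : {vspace chain} := (chains k :&: lker boundary)%VS.

Definition boundaries (k : nat) : {vspace chain} := (boundary @: chains k.+1)%VS.

Lemma boundaries_sub k : (boundaries k <= cycles k)%VS.
Proof.
rewrite subv_cap; apply/andP; split; last first.
  by apply/subvP => c /memv_imgP[d _ ->]; rewrite memv_ker boundary_boundary.
rewrite /boundaries limg_sum; apply/subv_sumP => s /andP[sD sk].
rewrite limg_line -memvE boundary_basis; apply: memv_suml => v /andP[vs sv].
apply: memvZ; rewrite memvE; apply: (sumv_sup (s :\ v)); last exact: subvv.
rewrite (simplex_face sD (subD1set _ _) sv) /=.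
by move: sk; rewrite (cardsD1 v) vs eqSS.
Qed.

End Chains.

(* The library provides the quotient additive group, to which the scaling is
   added here. *)
Section QuotientSpace.
Variables (K : fieldType) (V : vectType K) (U : {vspace V}).

Definition vquot : Type := Quotient.quot (pred_of_vspace U).
HB.instance Definition _ := GRing.Zmodule.on vquot.

Definition vquot_pi (x : V) : vquot :=
  (\pi_(Quotient.quot (pred_of_vspace U)) x)%qT.

Definition vquot_repr (q : vquot) : V := repr q.

Lemma vquot_piB : zmod_morphism vquot_pi.
Proof. by move=> x y; rewrite /vquot_pi raddfB. Qed.

HB.instance Definition _ :=
  GRing.isZmodMorphism.Build V vquot vquot_pi vquot_piB.

Lemma vquot_pi_eq x y : (vquot_pi x == vquot_pi y) = (x - y \in U).
Proof. by rewrite Quotient.idealrBE. Qed.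

Lemma vquot_reprK : cancel vquot_repr vquot_pi.
Proof. by move=> q; rewrite /vquot_pi /vquot_repr reprK. Qed.

Definition vquot_scale (a : K) (q : vquot) : vquot :=
  vquot_pi (a *: vquot_repr q).

Lemma vquot_pi_scale a x : vquot_scale a (vquot_pi x) = vquot_pi (a *: x).
Proof.
apply/eqP; rewrite /vquot_scale vquot_pi_eq -scalerBr rpredZ //.
by rewrite -vquot_pi_eq vquot_reprK.
Qed.

Lemma vquot_scalerA a b q :
  vquot_scale a (vquot_scale b q) = vquot_scale (a * b) q.
Proof. by rewrite -[q]vquot_reprK !vquot_pi_scale scalerA. Qed.

Lemma vquot_scale1r : left_id 1 vquot_scale.
Proof. by move=> q; rewrite -[q]vquot_reprK vquot_pi_scale scale1r. Qed.

Lemma vquot_scalerDr : right_distributive vquot_scale +%R.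
Proof.
move=> a q r; rewrite -[q]vquot_reprK -[r]vquot_reprK -raddfD !vquot_pi_scale.
by rewrite -raddfD scalerDr.
Qed.

Lemma vquot_scalerDl q : {morph vquot_scale^~ q : a b / a + b}.
Proof.
by move=> a b; rewrite -[q]vquot_reprK !vquot_pi_scale scalerDl raddfD.
Qed.

HB.instance Definition _ := GRing.Zmodule_isLmodule.Build K vquot
  vquot_scalerA vquot_scale1r vquot_scalerDr vquot_scalerDl.

Lemma vquot_piZ : scalable vquot_pi.
Proof. by move=> a x; rewrite -vquot_pi_scale. Qed.

HB.instance Definition _ :=
  GRing.isScalable.Build K V vquot *:%R vquot_pi vquot_piZ.

End QuotientSpace.

Section QuotientMap.
Variables (K : fieldType) (V W : vectType K).
Variables (U : {vspace V}) (U' : {vspace W}) (f : 'Hom(V, W)).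

(* The linear map [V / U -> W / U'] induced by [f], given [f @: U <= U']. *)
Definition vquot_map of (f @: U <= U')%VS :=
  fun q : vquot U => vquot_pi U' (f (vquot_repr q)).

Variable fU : (f @: U <= U')%VS.

Lemma vquot_map_pi x : vquot_map fU (vquot_pi U x) = vquot_pi U' (f x).
Proof.
apply/eqP; rewrite vquot_pi_eq -raddfB (subvP fU) // memv_img //.
by rewrite -vquot_pi_eq vquot_reprK.
Qed.

Lemma vquot_map_is_linear : linear (vquot_map fU).
Proof.
move=> a q r; rewrite -[q]vquot_reprK -[r]vquot_reprK -linearP.
by rewrite !vquot_map_pi !linearP.
Qed.

HB.instance Definition _ := GRing.isLinear.Build K (vquot U) (vquot U') *:%R
  (vquot_map fU) vquot_map_is_linear.

End QuotientMap.

Section Homology.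
Variables (K : fieldType) (T : finType).
Implicit Types (D E G : scomplex T) (k : nat).

Definition bounding_cycles D k : {vspace subvs_of (cycles K D k)} :=
  (linfun vsval @^-1: boundaries K D k)%VS.

Lemma bounding_cyclesE D k z :
  (z \in bounding_cycles D k) = (vsval z \in boundaries K D k).
Proof. by rewrite /bounding_cycles -memv_preim lfunE. Qed.

Definition homology D k : lmodType K := vquot (bounding_cycles D k).

Definition cycle_incl D E k :
    'Hom(subvs_of (cycles K D k), subvs_of (cycles K E k)) :=
  linfun (vsproj (cycles K E k) \o vsval).

Lemma chains_incl D E k : D \subset E -> (chains K D k <= chains K E k)%VS.
Proof.
move=> DE; apply/subv_sumP => s /andP[sD sk]; apply: (sumv_sup s) => //.
by rewrite (fintype.subsetP DE).
Qed.

Lemma cycle_inclE D E k (z : subvs_of (cycles K D k)) :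
  D \subset E -> vsval (cycle_incl D E k z) = vsval z.
Proof.
move=> DE; rewrite lfunE /= vsprojK //; have := subvsP z.
by apply: subvP; rewrite capvS ?chains_incl.
Qed.

Lemma bounding_cycles_incl D E k : D \subset E ->
  (cycle_incl D E k @: bounding_cycles D k <= bounding_cycles E k)%VS.
Proof.
move=> DE; apply/subvP => _ /memv_imgP[z zB ->].
move: zB; rewrite !bounding_cyclesE cycle_inclE //.
by apply: subvP; rewrite limgS ?chains_incl.
Qed.

Definition homology_incl D E k (DE : D \subset E) :
    {linear homology D k -> homology E k} :=
  vquot_map (bounding_cycles_incl k DE).

Lemma homology_incl_id D k (DD : D \subset D) (h : homology D k) :
  homology_incl k DD h = h.
Proof.
rewrite -[h]vquot_reprK /= vquot_map_pi; congr vquot_pi.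
by apply: val_inj; rewrite /= cycle_inclE.
Qed.

Lemma homology_incl_comp D E G k (DE : D \subset E) (EG : E \subset G)
    (DG : D \subset G) (h : homology D k) :
  homology_incl k EG (homology_incl k DE h) = homology_incl k DG h.
Proof.
rewrite -[h]vquot_reprK /= !vquot_map_pi; congr vquot_pi.
by apply: val_inj; rewrite /= !cycle_inclE.
Qed.

End Homology.

Record filtration (R : realType) (T : finType) := Filtration {
  filtration_at :> {posnum R} -> scomplex T;
  filtration_le : forall e e' : {posnum R}, e%:num <= e'%:num ->
    filtration_at e \subset filtration_at e' }.

Record pmodule (R : realType) (K : fieldType) := PModule {
  pm_space :> {posnum R} -> lmodType K;
  pm_map : forall e e' : {posnum R}, e%:num <= e'%:num ->
    {linear pm_space e -> pm_space e'};
  pm_map_id : forall e (le_ee : e%:num <= e%:num) (x : pm_space e),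
    pm_map le_ee x = x;
  pm_map_comp : forall e e' e'' (l1 : e%:num <= e'%:num)
    (l2 : e'%:num <= e''%:num) (l3 : e%:num <= e''%:num) (x : pm_space e),
    pm_map l2 (pm_map l1 x) = pm_map l3 x }.

Definition lmod_trivial (K : fieldType) (V : lmodType K) : Prop :=
  forall x : V, x = 0.

Definition pm_trivial (R : realType) (K : fieldType) (M : pmodule R K) : Prop :=
  forall e, lmod_trivial (M e).

Definition persistent_homology (R : realType) (K : fieldType) (T : finType)
    (D : filtration R T) (k : nat) : pmodule R K :=
  @PModule R K (fun e => homology K (D e) k)
    (fun e e' ee' => homology_incl K k (filtration_le D ee'))
    (fun e ee => homology_incl_id (filtration_le D ee))
    (fun e e' e'' l1 l2 l3 => homology_incl_comp (filtration_le D l1)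
       (filtration_le D l2) (filtration_le D l3)).

Section Cech.
Variables (R : realType) (n : nat) (F : finsler R n) (X : {fset 'rV[R]_n}).

Definition cech_simplices (e : R) : {set {set X}} :=
  [set s : {set X} | (s != set0) &&
     `[< (\bigcap_(p in [set` s]) finsler_ball F e (val p) !=set0)%classic >]].

Lemma cech_neq0 e : set0 \notin cech_simplices e.
Proof. by rewrite inE eqxx. Qed.

Lemma cech_vertex (e : {posnum R}) (p : X) : [set p] \in cech_simplices e%:num.
Proof.
rewrite inE; apply/andP; split.
  by apply/set0Pn; exists p; rewrite inE.
apply/asboolP; exists (val p) => q /=; rewrite inE => /eqP ->.
by rewrite /finsler_ball /= subrr finsler0.
Qed.

Lemma cech_face e (s t : {set X}) : s \in cech_simplices e ->
  t \subset s -> t != set0 -> t \in cech_simplices e.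
Proof.
rewrite !inE => /andP[_ /asboolP[x xs]] ts -> /=.
by apply/asboolP; exists x => p /= /(fintype.subsetP ts) /xs.
Qed.

Definition cech_complex (e : {posnum R}) : scomplex X :=
  SComplex (cech_neq0 e%:num) (cech_vertex e) (@cech_face e%:num).

Lemma cech_le (e e' : {posnum R}) : e%:num <= e'%:num ->
  cech_complex e \subset cech_complex e'.
Proof.
move=> ee'; apply/fintype.subsetP => s; rewrite !inE => /andP[-> /=].
move=> /asboolP[x xs]; apply/asboolP; exists x => p /xs.
by rewrite /finsler_ball /= => /le_trans; apply.
Qed.

Definition cech_filtration : filtration R X := Filtration cech_le.

End Cech.

(* Main.v *)
Require Import Defs.
From mathcomp Require Import all_boot all_order all_algebra finmap.
From mathcomp Require Import all_classical all_reals interval_inference.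
From mathcomp Require Import topology normedtype derive convex realfun.
From mathcomp Require Import ring lra.

(** The balls are convex, so the Čech complex is the nerve of a finite family
    of convex sets in an [n]-dimensional space, and such a nerve has no homology
    above degree [n].

    Vanishing for nerves ([nerve_vanishing]) goes by induction on the dimension
    of an affine subspace containing the sets, and then on the number of faces
    of the nerve.  The sets are first taken compact.  If the common parts of any
    two faces meet, the faces are closed under union, so the nerve is a full
    simplex, which is a cone.  Otherwise two faces have disjoint common parts,
    which some hyperplane separates strictly.  Cutting every set by the two
    closed half-spaces it bounds gives two subfamilies whose nerves cover the
    nerve, since a point lies in one half-space or the other; each of them lacks
    one of the two faces.  By convexity, a face whose common part reaches both
    half-spaces has a common point on the hyperplane, so the two nerves intersect
    in the nerve of the traces on the hyperplane, of dimension one less.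
    A Mayer-Vietoris argument ([vanishing_setU]) concludes.  Compactness costs
    nothing: one witness is chosen in the common part of each face, and each set
    is replaced by the convex hull of the witnesses it must contain
    ([compact_model]).

    Convexity of the balls ([convex_finsler_ball]) is local calculus: along
    a segment avoiding the origin, the second derivative of the squared norm is
    a value of the Hessian form, hence the squared norm is convex there; along
    a segment through the origin, homogeneity suffices. *)

Set Implicit Arguments.
Unset Strict Implicit.
Unset Printing Implicit Defensive.

Import Order.TTheory GRing.Theory Num.Theory.
Import numFieldNormedType.Exports.

Local Open Scope ring_scope.

(** * Mayer-Vietoris and cones for families of faces *)

Section Faces.
Import mathcomp.boot.finset.
Local Open Scope set_scope.
Local Open Scope ring_scope.
Variables (K : fieldType) (T : finType).
Implicit Types (N : {set {set T}}) (s t : {set T}) (v : T) (k : nat).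
Implicit Types (c z : chain K T).

(** Families of faces are used rather than the type of complexes, where every
    point of [T] is a vertex: cutting the sets of a family may empty some of
    them, which removes vertices from the nerve. *)
Definition face_closed N := forall s t,
  s \in N -> t \subset s -> t != set0 -> t \in N.

Definition face_chains N k : {vspace chain K T} :=
  (\sum_(s in N | #|s| == k.+1) <[basis_chain K s]>)%VS.

(** Vanishing of the homology in degree [k], stated on chains. *)
Definition vanishing N k : bool :=
  (face_chains N k :&: lker (boundary K T)
     <= boundary K T @: face_chains N k.+1)%VS.

Lemma face_chainsP N k c :
  reflect (forall s, c s != 0 -> s \in N /\ #|s| = k.+1)
          (c \in face_chains N k).
Proof.
apply: (iffP idP) => [|supp].
  move=> /memv_sumP[x xN ->] s; rewrite sum_ffunE => /eqP.
  have [[sN /eqP sk]|sNk] := pselect (s \in N /\ #|s| == k.+1); first by [].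
  rewrite big1 // => t tN; have /vlineP[a ->] := xN t tN.
  rewrite !ffunE; case: eqP => [st|_]; last by rewrite scaler0.
  by case: sNk; rewrite st; apply/andP.
rewrite [c]chain_basis; apply: memv_suml => s _.
have [->|cs] := eqVneq (c s) 0; first by rewrite scale0r mem0v.
have [sN sk] := supp s cs.
by apply: memvZ; rewrite memvE; apply: (sumv_sup s); rewrite ?sN ?sk /=.
Qed.

Lemma boundary_coef c t :
  boundary K T c t = \sum_s c s * simplex_boundary K s t.
Proof. by rewrite boundaryE sum_ffunE; apply: eq_bigr => s _; rewrite ffunE. Qed.

Lemma simplex_boundary_supp s t : simplex_boundary K s t != 0 ->
  t != set0 /\ exists2 v, v \in s & t = s :\ v.
Proof.
rewrite sum_ffunE => h.
case: (pickP [pred v | [&& v \in s, s :\ v != set0 & t == s :\ v]]).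
  by move=> v /= /and3P[vs sv /eqP ->]; split => //; exists v.
move=> none; move: h; rewrite big1 ?eqxx // => v /andP[vs sv].
by rewrite !ffunE; have := none v; rewrite /= vs sv /= => ->; rewrite scaler0.
Qed.

Lemma boundary_face_chains N k c : face_closed N ->
  c \in face_chains N k.+1 -> boundary K T c \in face_chains N k.
Proof.
move=> Nf /face_chainsP cN; apply/face_chainsP => t; rewrite boundary_coef.
case: (pickP [pred s | (c s != 0) && (simplex_boundary K s t != 0)]).
  move=> s /= /andP[/cN[sN sk] /simplex_boundary_supp[t0 [v vs ts]]] _.
  move: sk; rewrite (cardsD1 v) vs -ts => -[tk]; split => //.
  by apply: Nf sN _ t0; rewrite ts subD1set.
move=> none; rewrite big1 ?eqxx // => s _; have /= := none s.
by case: eqP => [->|_]; [rewrite mul0r|case: eqP => [->|//]; rewrite mulr0].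
Qed.

(** A chain all of whose faces contain [v] determines itself from the part of
    its boundary away from [v]: the face [t] arises there only from [v |: t]. *)
Lemma boundary_star_coef v c t : (forall s, c s != 0 -> v \in s) ->
  v \notin t -> t != set0 ->
  boundary K T c t = (-1) ^+ vertex_pos (v |: t) v * c (v |: t).
Proof.
move=> cv vt t0; have vtD : (v |: t) :\ v = t by rewrite setU1K.
rewrite boundary_coef (bigD1 (v |: t)) //= big1 => [|s svt]; last first.
  have [->|cs] := eqVneq (c s) 0; first by rewrite mul0r.
  have [->|/simplex_boundary_supp[_ [u us ts]]] :=
    eqVneq (simplex_boundary K s t) 0; first by rewrite mulr0.
  have uv : u = v.
    by apply/eqP; move: vt; rewrite ts !inE cv // andbT negbK eq_sym.
  by move: svt; rewrite ts uv setD1K ?eqxx ?cv.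
rewrite addr0 mulrC; congr (_ * _); rewrite sum_ffunE.
rewrite (bigD1 v) /=; last by rewrite setU11 vtD.
rewrite big1 => [|u /andP[/andP[uvt _] uv]]; last first.
  rewrite !ffunE; case: eqP => [tE|_]; last by rewrite scaler0.
  by move: vt; rewrite tE !inE eqxx eq_sym uv.
by rewrite addr0 !ffunE vtD eqxx /GRing.scale /= mulr1.
Qed.

(** Joining the faces of a cycle to [v], with the right sign, gives a chain whose
    boundary agrees with the cycle on the faces avoiding [v].  The difference is
    then a cycle all of whose faces contain [v], and it vanishes by
    [boundary_star_coef]. *)
Lemma vanishing_cone N v k : (forall s, s \in N -> v |: s \in N) ->
  vanishing N k.+1.
Proof.
move=> Nv; apply/subvP => z; rewrite memv_cap memv_ker => /andP[zN /eqP dz].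
have /face_chainsP zs := zN.
pose w : chain K T :=
  [ffun s : {set T} =>
     if v \in s then (-1) ^+ vertex_pos s v * z (s :\ v) else 0].
have wv (s : {set T}) : w s != 0 -> v \in s.
  by rewrite ffunE; case: ifP; rewrite // eqxx.
have wN : w \in face_chains N k.+2.
  apply/face_chainsP => s; rewrite ffunE; case: ifP => [vs|]; last by rewrite eqxx.
  rewrite mulf_eq0 signr_eq0 /= => /zs[sN sk].
  by rewrite (cardsD1 v) vs sk -(setD1K vs) Nv.
(* The boundary of [w] absorbs the part of [z] that avoids [v]. *)
suff zE : z = boundary K T w by rewrite zE memv_img.
have yv (s : {set T}) : (z - boundary K T w) s != 0 -> v \in s.
  apply: contraNT => vs; rewrite !ffunE.
  have [->|s0] := eqVneq s set0.
    have -> : z set0 = 0.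
      by apply/eqP; apply/negP => /negP /zs[_]; rewrite cards0.
    rewrite add0r oppr_eq0; apply/eqP; rewrite boundary_coef big1 // => t _.
    have [->|/simplex_boundary_supp[]] :=
      eqVneq (simplex_boundary K t set0) 0; first by rewrite mulr0.
    by rewrite eqxx.
  rewrite (boundary_star_coef wv) // ffunE setU11 setU1K // mulrA -expr2.
  by rewrite sqrr_sign mul1r subrr.
have dy : boundary K T (z - boundary K T w) = 0.
  by rewrite linearB /= dz boundary_boundary subr0.
have /face_chainsP dwN : z - boundary K T w \in face_chains [set: {set T}] k.+1.
  apply: rpredB; last first.
    apply: boundary_face_chains; first by move=> *; rewrite inE.
    by apply/face_chainsP => s /(face_chainsP _ _ _ wN)[_ ->]; rewrite inE.
  by apply/face_chainsP => s /zs[_ ->]; rewrite inE.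
apply/eqP; rewrite -subr_eq0; apply/eqP/ffunP => s; rewrite [RHS]ffunE.
apply/eqP/negP => /negP ys.
have [_ sk] := dwN s ys; have vs := yv s ys.
have := congr1 (fun c : chain K T => c (s :\ v)) dy; rewrite [RHS]ffunE.
rewrite (boundary_star_coef yv) ?setD1K //; last 2 first.
- by rewrite !inE eqxx.
- by apply/eqP => s0; move: sk; rewrite (cardsD1 v) vs s0 cards0.
by move/eqP; rewrite mulf_eq0 signr_eq0 (negbTE ys).
Qed.

(** The piece of the Mayer-Vietoris sequence around the homology of the union,
    on chains: a cycle [z] splits as [a + (z - a)] along the two families, the
    boundary of [a] lies in their intersection and bounds some [w] there, and
    [a - w] and [z - a + w] are cycles, one in each family. *)
Lemma vanishing_setU N1 N2 k : face_closed N1 -> face_closed N2 ->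
  vanishing N1 k.+1 -> vanishing N2 k.+1 -> vanishing (N1 :&: N2) k ->
  vanishing (N1 :|: N2) k.+1.
Proof.
move=> f1 f2 van1 van2 van12.
have face_chainsS N N' j : N \subset N' ->
    (face_chains N j <= face_chains N' j)%VS.
  move=> NN'; apply/subvP => c /face_chainsP cN; apply/face_chainsP => s /cN[sN].
  by split => //; apply: (fintype.subsetP NN').
apply/subvP => z; rewrite memv_cap memv_ker => /andP[/face_chainsP zN /eqP dz].
pose a : chain K T := [ffun s : {set T} => if s \in N1 then z s else 0].
have aN : a \in face_chains N1 k.+1.
  apply/face_chainsP => s; rewrite ffunE; case: ifP => [sN /zN[]|]//.
  by rewrite eqxx.
have bN : z - a \in face_chains N2 k.+1.
  apply/face_chainsP => s; rewrite !ffunE.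
  case: ifPn => sN; first by rewrite subrr eqxx.
  by rewrite subr0 => /zN[]; rewrite inE (negbTE sN).
have db : boundary K T (z - a) = - boundary K T a.
  by rewrite linearB /= dz sub0r.
have daN : boundary K T a \in face_chains (N1 :&: N2) k.
  have /face_chainsP d1 := boundary_face_chains f1 aN.
  have /face_chainsP d2 := boundary_face_chains f2 bN.
  apply/face_chainsP => s ds; have [s1 sk] := d1 s ds; split=> //.
  by rewrite inE s1 /=; have [|] := d2 s; rewrite // db ffunE oppr_eq0.
have /memv_imgP[w wN dw] : boundary K T a \in
    (boundary K T @: face_chains (N1 :&: N2) k.+1)%VS.
  by apply: (subvP van12); rewrite memv_cap daN memv_ker boundary_boundary /=.
have /memv_imgP[u1 u1N du1] : a - w \in (boundary K T @: face_chains N1 k.+2)%VS.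
  apply: (subvP van1); rewrite memv_cap memv_ker linearB /= -dw subrr eqxx andbT.
  by rewrite rpredB // (subvP (face_chainsS _ _ _ _) _ wN) // subsetIl.
have /memv_imgP[u2 u2N du2] :
    z - a + w \in (boundary K T @: face_chains N2 k.+2)%VS.
  apply: (subvP van2); rewrite memv_cap memv_ker linearD /= db -dw addNr eqxx andbT.
  by rewrite rpredD // (subvP (face_chainsS _ _ _ _) _ wN) // subsetIr.
apply/memv_imgP; exists (u1 + u2).
  by rewrite rpredD // (subvP (face_chainsS _ _ _ _) _ u1N,
    subvP (face_chainsS _ _ _ _) _ u2N) ?subsetUl ?subsetUr.
by rewrite linearD /= -du1 -du2 addrC addrACA subrK subrr addr0.
Qed.

(** A largest face contains all the others, so the family is a full simplex and
    any of its vertices is the apex of a cone. *)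
Lemma vanishing_union_closed N k :
  face_closed N -> {in N &, forall s t, s :|: t \in N} -> vanishing N k.+1.
Proof.
move=> Nf NU.
have [/eqP|/set0Pn[s0 s0N]] := boolP (N == set0).
  move=> ->; apply/subvP => z; rewrite memv_cap => /andP[/face_chainsP zN _].
  suff -> : z = 0 by rewrite mem0v.
  apply/ffunP => s; rewrite ffunE; apply/eqP; apply/negP => /negP /zN[].
  by rewrite inE.
case: (arg_maxnP (fun s : {set T} => #|s|) s0N) => V VN Vmax.
have sub s : s \in N -> s \subset V.
  move=> sN; have /Vmax := NU s V sN VN => le.
  have /eqP -> : V == s :|: V by rewrite eqEcard subsetUr.
  exact: subsetUl.
have [V0|/set0Pn[v vV]] := eqVneq V set0.
  apply/subvP => z; rewrite memv_cap => /andP[/face_chainsP zN _].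
  suff -> : z = 0 by rewrite mem0v.
  apply/ffunP => s; rewrite ffunE; apply/eqP; apply/negP => /negP /zN[/sub].
  by rewrite V0 subset0 => /eqP ->; rewrite cards0.
apply: (@vanishing_cone _ v) => s /sub sV; apply: Nf VN _ _.
  by rewrite subUset sub1set vV.
by apply/set0Pn; exists v; rewrite setU11.
Qed.

End Faces.

Lemma homology_trivial (K : fieldType) (T : finType) (D : scomplex T) k :
  vanishing K D k -> lmod_trivial (homology K D k).
Proof.
move=> van x; rewrite -[x]vquot_reprK; set z := vquot_repr x.
apply/eqP; rewrite -(raddf0 (vquot_pi (bounding_cycles K D k))) vquot_pi_eq subr0.
by rewrite bounding_cyclesE; apply: (subvP van); apply: subvsP.
Qed.

(** * Separation of compact convex sets *)

Section Convex.
Variables (R : realType) (n : nat).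
Implicit Types (A B D : set 'rV[R]_n) (x y : 'rV[R]_n) (w : 'cV[R]_n).

Lemma convex_setP A : convex_set A <-> forall x y (t : R),
  A x -> A y -> 0 <= t <= 1 -> A (t *: x + (1 - t) *: y).
Proof.
split=> [cA x y t Ax Ay t01|cA x y t /set_mem Ax /set_mem Ay]; last first.
  by apply/mem_set; apply: cA; rewrite // ge0 le1.
have /andP[t0 t1] := t01.
have := cA x y (Itv01 t0 t1) (mem_set Ax) (mem_set Ay).
by move/set_mem.
Qed.

(** Jensen's inclusion in homogeneous form: it is the multiples of points of [A]
    that are stable under addition. *)
Lemma convex_sum A (I : Type) (r : seq I) (a : I -> R) (u : I -> 'rV[R]_n) :
  convex_set A -> (A !=set0)%classic -> (forall i, 0 <= a i) ->
  (forall i, a i != 0 -> A (u i)) ->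
  exists2 y, A y & \sum_(i <- r) a i *: u i = (\sum_(i <- r) a i) *: y.
Proof.
move=> /convex_setP cA [y0 Ay0] a0 Au.
suff [] : 0 <= \sum_(i <- r) a i /\
  exists2 y, A y & \sum_(i <- r) a i *: u i = (\sum_(i <- r) a i) *: y by [].
apply: (big_ind2 (fun v (b : R) => 0 <= b /\ exists2 y, A y & v = b *: y)).
- by split=> //; exists y0; rewrite ?scale0r.
- move=> _ b _ c [b0 [y Ay ->]] [c0 [z Az ->]].
  split; first exact: addr_ge0.
  have [bc0|bc0] := eqVneq (b + c) 0.
    have [-> ->] : b = 0 /\ c = 0 by lra.
    by exists y; rewrite // addr0 !scale0r addr0.
  have {bc0} bc0 : 0 < b + c by rewrite lt_def bc0 addr_ge0.
  exists ((b / (b + c)) *: y + (1 - b / (b + c)) *: z).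
    by apply: cA; rewrite // divr_ge0 ?(ltW bc0) //= ler_pdivrMr // mul1r lerDl.
  rewrite scalerDr !scalerA mulrBr mulr1 mulrC divfK ?gt_eqF //.
  by rewrite [b + c]addrC addrK.
- move=> i _; split; first exact: a0.
  have [->|ai] := eqVneq (a i) 0; first by exists y0; rewrite ?scale0r.
  by exists (u i) => //; apply: Au.
Qed.

Lemma mulmxr_continuous m (M : 'M[R]_(m, n)) :
  continuous (fun a : 'rV[R]_m => a *m M).
Proof.
have -> : (fun a : 'rV[R]_m => a *m M) =
    \sum_(i < m) (fun a : 'rV[R]_m => a 0 i *: row i M).
  by apply/funext => a; rewrite mulmx_sum_row fct_sumE.
move=> a; apply: differentiable_continuous; apply: differentiable_sum => i.
by apply: differentiableZl; apply: differentiable_coord.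
Qed.

Lemma sqnorm_continuous : continuous (fun v : 'rV[R]_n => (v *m v^T) 0 0).
Proof.
have -> : (fun v : 'rV[R]_n => (v *m v^T) 0 0) =
    \sum_(j < n) (fun v : 'rV[R]_n => v 0 j * v 0 j).
  apply/funext => v; rewrite fct_sumE mxE.
  by apply: eq_bigr => j _; rewrite mxE.
move=> v; apply: differentiable_continuous; apply: differentiable_sum => j.
by apply: differentiableM; apply: differentiable_coord.
Qed.

Lemma sqnorm_gt0 (v : 'rV[R]_n) : v != 0 -> 0 < (v *m v^T) 0 0.
Proof.
move=> v0; have [j vj] : exists j, v 0 j != 0.
  by apply/existsP; apply: contraR v0 => /existsPn v0; apply/eqP/rowP => j;
    rewrite mxE; have := v0 j; rewrite negbK => /eqP.
rewrite mxE (bigD1 j) //= ltr_wpDr //; last first.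
  by rewrite mxE -expr2 exprn_even_gt0.
by apply: sumr_ge0 => i _; rewrite mxE -expr2 sqr_ge0.
Qed.

Lemma mulmx00D w x y : ((x + y) *m w) 0 0 = (x *m w) 0 0 + (y *m w) 0 0.
Proof. by rewrite mulmxDl [LHS]mxE. Qed.

Lemma mulmx00B w x y : ((x - y) *m w) 0 0 = (x *m w) 0 0 - (y *m w) 0 0.
Proof. by rewrite mulmxBl [LHS]mxE [X in _ + X]mxE. Qed.

Lemma mulmx00Z w a x : ((a *: x) *m w) 0 0 = a * (x *m w) 0 0.
Proof. by rewrite -scalemxAl [LHS]mxE. Qed.

Lemma dotmxC x y : (x *m y^T) 0 0 = (y *m x^T) 0 0.
Proof. by rewrite -[in RHS](trmxK y) -trmx_mul [RHS]mxE. Qed.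

(** The point of [D] nearest to the origin: moving from it towards another point
    [v] cannot decrease the norm to first order. *)
Lemma nearest_origin D : compact D -> convex_set D -> (D !=set0)%classic ->
  exists2 d, D d & forall v, D v -> (d *m d^T) 0 0 <= (v *m d^T) 0 0.
Proof.
move=> Dc /convex_setP Dx D0.
have qc : {within D, continuous (fun v : 'rV[R]_n => (v *m v^T) 0 0)}%classic.
  exact/continuous_subspaceT/sqnorm_continuous.
have [d /set_mem Dd dmin] := EVT_min_rV D0 Dc qc.
exists d => // v Dv; rewrite -subr_ge0.
have -> : (v *m d^T) 0 0 - (d *m d^T) 0 0 = ((v - d) *m d^T) 0 0.
  by rewrite mulmx00B.
set e := v - d; rewrite leNgt; apply/negP => a0.
have b0 : 0 <= (e *m e^T) 0 0.
  have [->|/sqnorm_gt0/ltW//] := eqVneq e 0.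
  by rewrite mul0mx mxE.
set a := (e *m d^T) 0 0 in a0; set b := (e *m e^T) 0 0 in b0.
(* With this step the second-order term [t * b] is at most [- a], half of the
   first-order gain. *)
pose t := - a / (b - a).
have ba : 0 < b - a by lra.
have t0 : 0 < t by rewrite divr_gt0 // oppr_gt0.
have t1 : t <= 1 by rewrite ler_pdivrMr // mul1r; lra.
have /dmin : (t *: v + (1 - t) *: d) \in D.
  by apply/mem_set; apply: Dx; rewrite // t1 ltW.
have -> : t *: v + (1 - t) *: d = d + t *: e.
  by rewrite /e scalerBl scale1r scalerBr addrCA.
have -> : ((d + t *: e) *m (d + t *: e)^T) 0 0 =
    (d *m d^T) 0 0 + t * (2 * a + t * b).
  rewrite mulmx00D mulmx00Z (dotmxC d) (dotmxC e) !mulmx00D !mulmx00Z.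
  by rewrite (dotmxC d e) -/a -/b; ring.
rewrite -subr_ge0 addrAC subrr add0r pmulr_rge0 // => le0.
have : t * b <= - a.
  by rewrite mulrAC ler_pdivrMr // ler_wpM2l //; lra.
by lra.
Qed.

(** The hyperplane is the perpendicular bisector of a shortest segment between
    the two sets; its normal vector is thus a difference of points of them,
    which keeps it in the direction space of any affine subspace containing
    both. *)
Lemma strict_separation A B : compact A -> compact B ->
  convex_set A -> convex_set B -> (A !=set0)%classic -> (B !=set0)%classic ->
  (forall x, A x -> ~ B x) ->
  exists x0 y0 c, let w := (y0 - x0)^T in
  [/\ A x0, B y0, forall x, A x -> (x *m w) 0 0 < c &
      forall y, B y -> c < (y *m w) 0 0].
Proof.
move=> Ac Bc /convex_setP Ax /convex_setP Bx [x1 Ax1] [y1 By1] AB0.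
pose D := ((fun p : 'rV[R]_n * 'rV[R]_n => p.1 - p.2) @` (B `*` A))%classic.
have Dc : compact D.
  apply: continuous_compact; last exact: compact_setX.
  exact/continuous_subspaceT/sub_continuous.
have Dx : convex_set D.
  apply/convex_setP => _ _ t [[y x] [/= By Axx] <-] [[y' x'] [/= By' Ax'] <-] t01.
  exists (t *: y + (1 - t) *: y', t *: x + (1 - t) *: x') => /=.
    by split; [apply: Bx|apply: Ax].
  by rewrite !scalerBr opprD addrACA.
have [d [[y0 x0] [/= By0 Ax0] dE] dmin] :=
  nearest_origin Dc Dx (ex_intro _ _ (ex_intro2 _ _ (y1, x1) (conj By1 Ax1) erefl)).
have d0 : d != 0.
  rewrite -dE subr_eq0; apply/eqP => yx; apply: (AB0 x0 Ax0).
  by rewrite -yx.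
exists x0, y0, (((x0 *m d^T) 0 0 + (y0 *m d^T) 0 0) / 2) => /=; rewrite dE.
have := sqnorm_gt0 d0; rewrite -[X in (X *m _) 0 0]dE mulmx00B => gt0.
have dmin' y x : B y -> A x ->
    (y0 *m d^T) 0 0 - (x0 *m d^T) 0 0 <= (y *m d^T) 0 0 - (x *m d^T) 0 0.
  move=> By Axx; rewrite -!mulmx00B dE.
  exact: (dmin (y - x) (ex_intro2 _ _ (y, x) (conj By Axx) erefl)).
by split=> // [x /(dmin' _ _ By0)|y /dmin'/(_ Ax0)]; lra.
Qed.

End Convex.

(** * Nerves of compact convex sets *)

Section Nerve.
Import mathcomp.boot.finset.
Variables (R : realType) (n : nat) (T : finType).
Implicit Types (C : T -> set 'rV[R]_n) (s t : {set T}).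

Definition common C s : set 'rV[R]_n := (\bigcap_(p in [set` s]) C p)%classic.

Definition nerve C : {set {set T}} :=
  [set s : {set T} | (s != set0) && `[< (common C s !=set0)%classic >]]%SET.

Lemma nerveP C s :
  reflect (s != set0 /\ exists x, forall p, p \in s -> C p x) (s \in nerve C).
Proof.
by rewrite inE; apply: (iffP andP) => -[-> /asboolP].
Qed.

Lemma nerve_face_closed C : face_closed (nerve C).
Proof.
move=> s t /nerveP[_ [x xs]] ts t0; apply/nerveP; split=> //.
by exists x => p /(fintype.subsetP ts) /xs.
Qed.

Lemma nerveS C C' : (forall p, C p `<=` C' p)%classic -> nerve C \subset nerve C'.
Proof.
move=> CC'; apply/fintype.subsetP => s /nerveP[s0 [x xs]].
by apply/nerveP; split=> //; exists x => p /xs /CC'.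
Qed.

Lemma compact_common C s : (forall p, compact (C p)) -> s != set0 ->
  compact (common C s).
Proof.
move=> Cc /set0Pn[p ps]; apply: (@subclosed_compact _ _ (C p)) => //.
- by apply: closed_bigI => q _; apply: compact_closed => //; apply: norm_hausdorff.
- by move=> x; apply.
Qed.

Lemma convex_common C s : (forall p, convex_set (C p)) -> convex_set (common C s).
Proof.
move=> Cx; apply/convex_setP => x y t xs ys t01 p ps.
by apply: (convex_setP _).1 => //; [apply: xs|apply: ys].
Qed.

Definition cut C (H : set 'rV[R]_n) : T -> set 'rV[R]_n :=
  fun p => (C p `&` H)%classic.

Lemma nerve_cutS C H : nerve (cut C H) \subset nerve C.
Proof. by apply: nerveS => p x []. Qed.

Lemma nerve_cutP C H s : reflect (s != set0 /\ exists2 x, common C s x & H x)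
  (s \in nerve (cut C H)).
Proof.
apply: (iffP (nerveP _ _)) => [[s0 [x xs]]|[s0 [x xs Hx]]]; split=> //.
  have /set0Pn[p ps] := s0.
  by exists x => [q qs|]; [have [] := xs q qs|have [] := xs p ps].
by exists x => p ps; split=> //; apply: xs.
Qed.

Lemma convex_cut C H p : convex_set (C p) -> convex_set H ->
  convex_set (cut C H p).
Proof.
move=> /convex_setP Cx /convex_setP Hx; apply/convex_setP => x y t [? ?] [? ?] ?.
by split; [apply: Cx|apply: Hx].
Qed.

Lemma nerve_cut_setU C H1 H2 : (forall x, H1 x \/ H2 x) ->
  nerve C = nerve (cut C H1) :|: nerve (cut C H2).
Proof.
move=> H12; apply/eqP; rewrite eqEsubset subUset !nerve_cutS !andbT.
apply/fintype.subsetP => s /nerveP[s0 [x xs]]; rewrite inE; apply/orP.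
have [Hx|Hx] := H12 x.
  by left; apply/nerve_cutP; split=> //; exists x.
by right; apply/nerve_cutP; split=> //; exists x.
Qed.

Section Halfspaces.
Variables (w : 'cV[R]_n) (c : R).

Definition halfspace_le := [set x : 'rV[R]_n | (x *m w) 0 0 <= c]%classic.
Definition halfspace_ge := [set x : 'rV[R]_n | c <= (x *m w) 0 0]%classic.
Definition hyperplane := [set x : 'rV[R]_n | (x *m w) 0 0 = c]%classic.

Lemma form_continuous : continuous (fun x : 'rV[R]_n => (x *m w) 0 0).
Proof.
move=> x; apply: (@continuous_comp _ _ _ (fun x : 'rV[R]_n => x *m w)
  (fun M : 'M[R]_(1, 1) => M 0 0)); last exact: coord_continuous.
exact: mulmxr_continuous.
Qed.

Lemma closed_halfspace_le : closed halfspace_le.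
Proof.
apply: (@preimage_closed _ _ (fun x : 'rV[R]_n => (x *m w) 0 0)
  [set r | r <= c]%classic).
  by move=> x _; apply: form_continuous.
exact: closed_le.
Qed.

Lemma closed_halfspace_ge : closed halfspace_ge.
Proof.
apply: (@preimage_closed _ _ (fun x : 'rV[R]_n => (x *m w) 0 0)
  [set r | c <= r]%classic).
  by move=> x _; apply: form_continuous.
exact: closed_ge.
Qed.

Lemma closed_hyperplane : closed hyperplane.
Proof.
apply: (@preimage_closed _ _ (fun x : 'rV[R]_n => (x *m w) 0 0)
  [set r | r = c]%classic).
  by move=> x _; apply: form_continuous.
exact: closed_eq.
Qed.

Lemma convex_halfspace_le : convex_set halfspace_le.
Proof.
apply/convex_setP => x y t; rewrite /halfspace_le /= => xc yc /andP[t0 t1].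
rewrite mulmx00D !mulmx00Z (_ : c = t * c + (1 - t) * c); last by ring.
by rewrite lerD // ler_wpM2l // subr_ge0.
Qed.

Lemma convex_halfspace_ge : convex_set halfspace_ge.
Proof.
apply/convex_setP => x y t; rewrite /halfspace_ge /= => xc yc /andP[t0 t1].
rewrite mulmx00D !mulmx00Z (_ : c = t * c + (1 - t) * c); last by ring.
by rewrite lerD // ler_wpM2l // subr_ge0.
Qed.

Lemma convex_hyperplane : convex_set hyperplane.
Proof.
apply/convex_setP => x y t; rewrite /hyperplane /= => xc yc _.
by rewrite mulmx00D !mulmx00Z xc yc; ring.
Qed.

(** Where convexity enters: a segment joining two common points of a face, one
    in each half-space, crosses the hyperplane. *)
Lemma nerve_cut_setI C : (forall p, convex_set (C p)) ->
  nerve (cut C halfspace_le) :&: nerve (cut C halfspace_ge) =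
  nerve (cut C hyperplane).
Proof.
move=> Cx; apply/setP => s; rewrite inE; apply/andP/nerve_cutP; last first.
  move=> [s0 [x xs xc]]; split; apply/nerve_cutP; split=> //; exists x => //.
    by rewrite /halfspace_le /= xc.
  by rewrite /halfspace_ge /= xc.
move=> [/nerve_cutP[s0 [x xs xc]] /nerve_cutP[_ [y ys yc]]]; split=> //.
move: xc yc; rewrite /halfspace_le /halfspace_ge /hyperplane /= => xc yc.
have [xE|xNc] := eqVneq ((x *m w) 0 0) c; first by exists x.
have {xNc xc} xc : (x *m w) 0 0 < c by rewrite lt_def eq_sym xNc.
pose t := ((y *m w) 0 0 - c) / ((y *m w) 0 0 - (x *m w) 0 0).
have xy : 0 < (y *m w) 0 0 - (x *m w) 0 0 by lra.
exists (t *: x + (1 - t) *: y).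
  apply: ((convex_setP _).1 (convex_common Cx)) => //.
  by rewrite divr_ge0 ?ler_pdivrMr //=; lra.
rewrite mulmx00D !mulmx00Z /t; field.
by rewrite gt_eqF.
Qed.

End Halfspaces.

Variable K : fieldType.

(** The row space of [U] is the direction of an affine subspace containing all
    the sets; keeping the ambient space fixed avoids choosing coordinates on the
    hyperplane.  The normal [y0 - x0] of the separating hyperplane lies in [U],
    so that cutting lowers the rank.  In dimension [0] no two nonempty sets are
    disjoint, hence no separate base case. *)
Theorem nerve_vanishing (U : 'M[R]_n) C k :
  (forall p, compact (C p)) -> (forall p, convex_set (C p)) ->
  (forall p q x y, C p x -> C q y -> (x - y <= U)%MS) ->
  (\rank U < k)%N -> vanishing K (nerve C) k.
Proof.
elim: k => [//|k IHk] in U C *.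
have [m] := ubnP #|nerve C|; elim: m => [//|m IHm] in C *.
rewrite ltnS => Nm Cc Cx CU Uk.
have [NU|NU] :=
  boolP [forall s in nerve C, forall t in nerve C, s :|: t \in nerve C].
  apply: vanishing_union_closed; first exact: nerve_face_closed.
  by move=> s t sN tN; have /forall_inP/(_ s sN)/forall_inP/(_ t tN) := NU.
have /forall_inPn[s sN /forall_inPn[t tN stN]] := NU.
have /nerveP[s0 [xs Cxs]] := sN; have /nerveP[t0 [xt Cxt]] := tN.
have disj x : common C s x -> ~ common C t x.
  move=> sx tx; move/negP: stN; apply; apply/nerveP; split.
    by rewrite -card_gt0 (leq_trans _ (subset_leq_card (subsetUl s t))) ?card_gt0.
  by exists x => p; rewrite inE => /orP[ps|pt]; [apply: sx|apply: tx].
have [x0 [y0 [c /=]]] := strict_separation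
  (compact_common Cc s0) (compact_common Cc t0) (convex_common Cx)
  (convex_common Cx) (ex_intro _ xs Cxs) (ex_intro _ xt Cxt) disj.
set w := (y0 - x0)^T => -[x0s y0t sc ct].
rewrite (@nerve_cut_setU _ (halfspace_le w c) (halfspace_ge w c)); last first.
  move=> x; rewrite /halfspace_le /halfspace_ge /=.
  by case: (leP ((x *m w) 0 0) c) => [|/ltW]; [left|right].
have cut_compact (H : set 'rV[R]_n) p : closed H -> compact (cut C H p).
  by move=> Hc; apply: compact_closedI.
have half (H : set 'rV[R]_n) s' : closed H -> convex_set H -> s' \in nerve C ->
    (forall x, common C s' x -> ~ H x) -> vanishing K (nerve (cut C H)) k.+1.
  move=> Hc Hx s'N s'H; apply: IHm => // [|p|p|p q x y [Cpx _] [Cqy _]].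
  - apply: leq_trans Nm; apply: proper_card; apply/properP.
    split; first exact: nerve_cutS.
    by exists s' => //; apply/nerve_cutP => -[_ [x /s'H]].
  - exact: cut_compact.
  - exact: convex_cut.
  - exact: CU Cpx Cqy.
apply: vanishing_setU; do ?exact: nerve_face_closed.
- apply: half tN _; [exact: closed_halfspace_le|exact: convex_halfspace_le|].
  by move=> y /ct; rewrite ltNge => /negP.
- apply: half sN _; [exact: closed_halfspace_ge|exact: convex_halfspace_ge|].
  by move=> x /sc; rewrite ltNge => /negP.
rewrite nerve_cut_setI //; apply: (IHk (U :&: kermx w)%MS).
- by move=> p; apply: cut_compact; apply: closed_hyperplane.
- by move=> p; apply: convex_cut => //; apply: convex_hyperplane.
- move=> p q x y [Cpx xc] [Cqy yc]; rewrite sub_capmx (CU p q) //=.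
  apply/sub_kermxP/matrixP => i j; rewrite !ord1 mulmx00B xc yc subrr.
  by rewrite mxE.
apply: leq_trans (_ : \rank U <= k)%N; last by rewrite -ltnS.
apply: rank_ltmx; rewrite ltmxE capmxSl /=; apply/negP => Uw.
have /set0Pn[p ps] := s0; have /set0Pn[q qt] := t0.
have /sub_kermxP yx : (y0 - x0 <= kermx w)%MS.
  apply: submx_trans (capmxSr U _); apply: submx_trans Uw.
  by apply: CU (y0t q qt) (x0s p ps).
have := lt_trans (sc _ x0s) (ct _ y0t).
by rewrite -subr_gt0 -mulmx00B yx mxE ltxx.
Qed.

End Nerve.

(** * Nerves of arbitrary convex sets *)

Section Hull.
Import mathcomp.boot.finset.
Variables (R : realType) (n : nat) (I : finType).
Implicit Types (x : I -> 'rV[R]_n) (J : pred I).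

(** The convex hull of the points [x i] with [J i].  The weights form a row
    vector indexed by all of [I], so that the hull is a linear image of a compact
    set of row vectors. *)
Definition hull x J : set 'rV[R]_n :=
  [set y : 'rV[R]_n | exists a : 'rV[R]_#|I|,
     [/\ forall i, 0 <= a 0 i <= 1, forall i, ~~ J (enum_val i) -> a 0 i = 0,
         \sum_i a 0 i = 1 & y = \sum_i a 0 i *: x (enum_val i)]]%classic.

Lemma hull_compact x J : compact (hull x J).
Proof.
pose A (i : 'I_#|I|) : set R :=
  (if J (enum_val i) then `[0, 1] else [set 0])%classic.
(* Written as a linear form, this set is closed as a hyperplane. *)
pose sum1 : set 'rV[R]_#|I| :=
  [set a : 'rV[R]_#|I| | (a *m const_mx 1 : 'rV_1) 0 0 = 1]%classic.
have -> : hull x J = ((fun a : 'rV[R]_#|I| => a *m \matrix_i x (enum_val i)) @`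
    ([set a : 'rV[R]_#|I| | forall i, A i (a 0 i)] `&` sum1))%classic.
  have sumE (a : 'rV[R]_#|I|) : (a *m const_mx 1 : 'rV_1) 0 0 = \sum_i a 0 i.
    by rewrite mxE; apply: eq_bigr => i _; rewrite mxE mulr1.
  have combE (a : 'rV[R]_#|I|) :
      a *m \matrix_i x (enum_val i) = \sum_i a 0 i *: x (enum_val i).
    by rewrite mulmx_sum_row; apply: eq_bigr => i _; rewrite rowK.
  apply/seteqP; split=> y.
    move=> [a [a01 aJ a1 ->]]; exists a; last exact: combE.
    split; last by rewrite /sum1 /= sumE.
    move=> i; rewrite /A; case: ifPn => [_|/aJ //].
    by rewrite /= in_itv /= a01.
  move=> [a [aA]]; rewrite /sum1 /= sumE => a1 <-; exists a; split => //.
    move=> i; have := aA i; rewrite /A; case: ifP => _ /=; first by rewrite in_itv.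
    by move=> ->; rewrite lexx ler01.
  by move=> i Ji; have := aA i; rewrite /A (negbTE Ji).
apply: continuous_compact.
  exact/continuous_subspaceT/mulmxr_continuous.
apply: compact_closedI; last exact: closed_hyperplane.
apply: rV_compact => i; rewrite /A; case: ifP => _; first exact: segment_compact.
exact: compact_set1.
Qed.

Lemma hull_convex x J : convex_set (hull x J).
Proof.
apply/convex_setP => _ _ t [a [a01 aJ a1 ->]] [b [b01 bJ b1 ->]] /andP[t0 t1].
exists (t *: a + (1 - t) *: b); split=> [i|i Ji||].
- have /andP[a0 al1] := a01 i; have /andP[b0 bl1] := b01 i.
  by rewrite !mxE; nra.
- by rewrite !mxE aJ // bJ // !mulr0 addr0.
- under eq_bigr do rewrite !mxE.
  by rewrite big_split /= -!mulr_sumr a1 b1; ring.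
- rewrite !scaler_sumr -big_split /=. apply: eq_bigr => i _.
  by rewrite !mxE !scalerA -scalerDl.
Qed.

Lemma mem_hull x (J : pred I) i : J i -> hull x J (x i).
Proof.
move=> Ji; exists (delta_mx 0 (enum_rank i)).
have E j : delta_mx 0 (enum_rank i) 0 j = (j == enum_rank i)%:R :> R.
  by rewrite mxE eqxx.
split=> [j|j|| ].
- by rewrite E; case: eqP; rewrite ?lexx ?ler01.
- by rewrite E; case: eqP => // ->; rewrite enum_rankK Ji.
- under eq_bigr do rewrite E.
  by rewrite (bigD1 (enum_rank i)) //= eqxx big1 ?addr0 // => j /negbTE ->.
- under eq_bigr do rewrite E.
  rewrite (bigD1 (enum_rank i)) //= eqxx big1 ?addr0 ?scale1r ?enum_rankK //.
  by move=> j /negbTE ->; rewrite scale0r.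
Qed.

Lemma hull_sub x J (A : set 'rV[R]_n) : convex_set A ->
  (forall i, J i -> A (x i)) -> (hull x J `<=` A)%classic.
Proof.
move=> cA AJ _ [a [a01 aJ a1 ->]].
have aA i : a 0 i != 0 -> A (x (enum_val i)).
  by move=> ai; apply: AJ; apply: contraR ai => /aJ ->.
have [i ai] : exists i, a 0 i != 0.
  apply/existsP; apply: contraT => /existsPn a0; move: a1.
  rewrite big1 => [/eqP|i _]; first by rewrite eq_sym oner_eq0.
  by apply/eqP; have := a0 i; rewrite negbK.
have [|y Ay ->] :=
  convex_sum (index_enum 'I_#|I|) cA (ex_intro _ _ (aA i ai)) _ aA.
  by move=> j; have /andP[] := a01 j.
by rewrite a1 scale1r.
Qed.

End Hull.

Section Reduction.
Import mathcomp.boot.finset.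
Variables (R : realType) (n : nat) (T : finType) (B : T -> set 'rV[R]_n).
Hypothesis Bx : forall p, convex_set (B p).

(** With [x s] a common point of the face [s], the hull of the [x s] for [s]
    containing [p] is a subset of [B p]; this keeps every face and creates
    none. *)
Lemma compact_model : exists C : T -> set 'rV[R]_n,
  [/\ forall p, compact (C p), forall p, convex_set (C p) & nerve C = nerve B].
Proof.
have [|x xP] := @choice _ _ (fun (s : {set T}) y =>
    s \in nerve B -> forall p, p \in s -> B p y).
  move=> s; case: (nerveP B s) => [[_ [y ys]]|_]; first by exists y.
  by exists 0.
pose J p (s : {set T}) := (s \in nerve B) && (p \in s).
exists (fun p => hull x (J p)); split=> [p|p|].
- exact: hull_compact.
- exact: hull_convex.
apply/eqP; rewrite eqEsubset; apply/andP; split.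
  by apply: nerveS => p; apply: hull_sub => // s /andP[sB]; apply: xP.
apply/fintype.subsetP => s sB; have /nerveP[s0 _] := sB.
apply/nerveP; split=> //; exists (x s) => p ps.
by apply: mem_hull; rewrite /J sB ps.
Qed.

Theorem convex_nerve_vanishing (K : fieldType) k : (n < k)%N ->
  vanishing K (nerve B) k.
Proof.
move=> nk; have [C [Cc Cx <-]] := compact_model.
apply: (@nerve_vanishing _ _ _ _ 1%:M) => // [p q x y _ _|].
  exact: submx1.
by rewrite mxrank1.
Qed.

End Reduction.

(** * Convexity of Finsler balls *)

Section Line.
Local Open Scope classical_set_scope.
Variables (R : realType) (n : nat).
Implicit Types (f : 'rV[R]_n -> R) (u v w : 'rV[R]_n).

Lemma open_neq0 v : v != 0 -> \forall u \near v, u != 0.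
Proof.
move=> v0; apply: open_nbhs_nbhs; split; last exact: v0.
have -> : (fun u : 'rV[R]_n => is_true (u != 0)) = ~` [set 0 : 'rV[R]_n].
  by apply/seteqP; split => u /= /eqP.
apply: closed_openC.
exact: compact_closed (@norm_hausdorff _ _) (@compact_set1 _ _).
Qed.

Lemma is_derive_line (f : 'rV[R]_n -> R) v w (t : R) :
  differentiable f (v + t *: w) ->
  is_derive t 1 (fun s => f (v + s *: w)) ('D_w f (v + t *: w)).
Proof.
move=> df.
have dl : is_diff t (fun s : R => v + s *: w) (fun s => s *: w).
  apply: is_diff_eq.
  by apply/funext => s; rewrite /= add0r.
have dg : differentiable (fun s : R => f (v + s *: w)) t.
  by apply: (@differentiable_comp _ _ _ _ (fun s : R => v + s *: w) f).
apply: DeriveDef; first by apply: diff_derivable.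
rewrite deriveE // deriveE //.
rewrite (@diff_comp _ _ _ _ (fun s : R => v + s *: w) f) //=.
by rewrite diff_val scale1r.
Qed.

(** The directional derivative of [f] need not be differentiable at the origin,
    so it is given through a function [h] with which it agrees elsewhere. *)
Lemma derive_hessian f (h : 'rV[R]_n -> 'rV[R]_n -> R) v w :
  (forall u, u != 0 -> differentiable f u) ->
  (forall e u, u != 0 -> 'D_e f u = h e u) ->
  (forall e u, u != 0 -> differentiable (h e) u) -> v != 0 ->
  'D_w (h w) v = (w *m hessian f v *m w^T) 0 0.
Proof.
move=> df fh dh v0.
have expand g u : differentiable g u ->
    'D_w g u = \sum_j w 0 j * 'D_(delta_mx 0 j) g u.
  move=> dg; rewrite deriveE // [in LHS](row_sum_delta w) linear_sum.
  by apply: eq_bigr => j _; rewrite linearZ /= deriveE.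
have -> : 'D_w (h w) v = 'D_w (\sum_j (fun u => w 0 j * h (delta_mx 0 j) u)) v.
  apply: near_eq_derive; near=> u.
  have u0 : u != 0 by near: u; apply: open_neq0.
  rewrite fct_sumE -fh // expand; last exact: df.
  by apply: eq_bigr => j _; rewrite fh.
rewrite derive_sum; last first.
  move=> j; apply: (@derivableZ _ _ _ (h (delta_mx 0 j))).
  by apply: diff_derivable; apply: dh.
rewrite mxE; apply: eq_bigr => j _; rewrite mxE.
rewrite (@deriveZ _ _ _ (h (delta_mx 0 j))); last first.
  by apply: diff_derivable; apply: dh.
rewrite [w^T _ _]mxE (expand _ _ (dh _ _ v0)) mulrC; congr (_ * _).
apply: eq_bigr => i _; rewrite /hessian mxE; congr (_ * _).
apply: near_eq_derive; near=> u; apply/esym/fh.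
by near: u; apply: open_neq0.
Unshelve. all: by end_near.
Qed.

End Line.

Section Ball.
Local Open Scope classical_set_scope.
Variables (R : realType) (n : nat) (F : finsler R n) (p : 'rV[R]_n).
Implicit Types (u v w x y : 'rV[R]_n).

(** Smoothness is known on pairs (base point, vector); [G'] is the partial
    derivative along the fibre over [p]. *)
Let G (xv : 'rV[R]_n * 'rV[R]_n) := F xv.1 xv.2.
Let G' w u : R := 'D_(0, w) G (p, u).

Let is_diff_section u : is_diff u (fun u : 'rV[R]_n => (p, u)) (fun u => (0, u)).
Proof. exact: is_diff_eq. Qed.

Let smoothG u : u != 0 -> differentiable G (p, u).
Proof. by move=> u0; have [/= dG _] := finsler_smooth F 1; apply: dG. Qed.

Let smoothG' w u : u != 0 -> differentiable ('D_(0, w) G) (p, u).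
Proof.
by move=> u0; have [_ /(_ (0, w))[/= dG _]] := finsler_smooth F 2; apply: dG.
Qed.

Let diffF u : u != 0 -> differentiable (F p) u.
Proof.
move=> u0; apply: (@differentiable_comp _ _ _ _ (fun u : 'rV[R]_n => (p, u)) G).
  by [].
exact: smoothG.
Qed.

Let deriveF w u : u != 0 -> 'D_w (F p) u = G' w u.
Proof.
move=> u0; rewrite /G' deriveE; last exact: diffF.
rewrite deriveE; last exact: smoothG.
rewrite (@diff_comp _ _ _ _ (fun u : 'rV[R]_n => (p, u)) G) //=.
  by rewrite diff_val.
exact: smoothG.
Qed.

Let f u := F p u ^+ 2.
Let h w u : R := F p u * (G' w u *+ 2).

Let fE : f = (F p : 'rV[R]_n -> R) ^+ 2.
Proof. by apply/funext => u; rewrite exprfctE. Qed.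

Let diff_f u : u != 0 -> differentiable f u.
Proof. by move=> u0; rewrite fE; apply: differentiableX; apply: diffF. Qed.

Let derive_f w u : u != 0 -> 'D_w f u = h w u.
Proof.
move=> u0; rewrite fE deriveX; last exact: diff_derivable (diffF u0).
by rewrite /= expr1 deriveF // /h /GRing.scale /=; ring.
Qed.

Let diff_h w u : u != 0 -> differentiable (h w) u.
Proof.
move=> u0; apply: (@differentiableM _ _ (F p) (fun u => G' w u *+ 2)).
  exact: diffF.
have dG' : differentiable (G' w) u.
  apply: (@differentiable_comp _ _ _ _ (fun u : 'rV[R]_n => (p, u))
    ('D_(0, w) G)) => //.
  exact: smoothG'.
rewrite (_ : (fun _ => _) = G' w + G' w); first exact: differentiableD.
by apply/funext => v; rewrite mulr2n.
Qed.

(** In [g (s) = f (x + s *: w)], the second derivative is the Hessian form of [f]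
    on [w]. *)
Let sqr_convex_segment x y (t : R) : 0 <= t <= 1 ->
  (forall s : R, 0 <= s <= 1 -> s *: x + (1 - s) *: y != 0) ->
  f (t *: x + (1 - t) *: y) <= t * f x + (1 - t) * f y.
Proof.
move=> t01 xy0; pose w := y - x; pose g (s : R) := f (x + s *: w).
have lineE (s : R) : x + s *: w = (1 - s) *: x + s *: y.
  by rewrite /w scalerBr scalerBl scale1r addrAC addrA.
have line0 (s : R) : 0 <= s <= 1 -> x + s *: w != 0.
  move=> s01; rewrite lineE -[X in X *: y](subKr 1 s); apply: xy0; lra.
have gd (s : R) : 0 <= s <= 1 -> is_derive s 1 g (h w (x + s *: w)).
  by move=> s01; rewrite -derive_f ?line0 //; apply/is_derive_line/diff_f/line0.
have gd2 (s : R) : 0 < s < 1 -> is_derive s 1 ('D_1 g) ('D_w (h w) (x + s *: w)).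
  move=> s01; have s01' : 0 <= s <= 1 by lra.
  apply: (@near_eq_is_derive _ _ _ (fun r : R => h w (x + r *: w))).
    near=> r; have r01 : 0 <= r <= 1.
      by apply/andP; split; apply: ltW; near: r;
        [apply: lt_nbhsr|apply: lt_nbhsl]; lra.
    by have := gd r r01 => gr; rewrite derive_val.
  by apply/is_derive_line/diff_h/line0.
have gc (s : R) : 0 <= s <= 1 -> {for s, continuous g}.
  move=> s01; apply: differentiable_continuous; apply/derivable1_diffP.
  by have [] := gd s s01.
have /andP[t0 t1] := t01.
have -> : t *: x + (1 - t) *: y = x + (1 - t) *: w.
  by rewrite lineE (subKr 1 t).
have -> : f x = g 0 by rewrite /g scale0r addr0.
have -> : f y = g 1 by rewrite /g scale1r /w addrC subrK.
have mid : conv (Itv01 t0 t1) (0 : R^o) 1 = 1 - t.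
  by rewrite convRE /= mulr0 mulr1 add0r.
have -> : f (x + (1 - t) *: w) = g (conv (Itv01 t0 t1) (0 : R^o) 1).
  by rewrite mid.
apply: (@second_derivative_convex R g 0 1 _ _ _ _ _ (Itv01 t0 t1)) => //.
- move=> s s01; have s01' : 0 <= s <= 1 by lra.
  have gs := gd2 s s01.
  rewrite derive_val (derive_hessian _ diff_f derive_f diff_h) ?line0 //.
  have [->|w0] := eqVneq w 0; first by rewrite !mul0mx mxE.
  by apply: ltW; apply: finsler_posdef => //; apply: line0.
- by apply: cvg_at_left_filter; apply: gc; rewrite ler01 lexx.
- by apply: cvg_at_right_filter; apply: gc; rewrite ler01 lexx.
- move=> s; rewrite in_itv /= => s01; have s01' : 0 <= s <= 1 by lra.
  by have [] := gd s s01'.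
- by move=> s; rewrite in_itv /= => s01; have [] := gd2 s s01.
Unshelve. all: by end_near.
Qed.

Let shrink a u : 0 <= a <= 1 -> F p (a *: u) <= F p u.
Proof.
move=> /andP[a0 a1]; have [->|aN0] := eqVneq a 0.
  by rewrite scale0r finsler0 finsler_ge0.
by rewrite finsler_homogeneous ?ler_piMl ?finsler_ge0 // lt_def aN0.
Qed.

(** If the segment from [x] to [y] contains the origin, the point considered is
    a multiple of [x] or of [y] by a factor in [[0, 1]], and homogeneity
    applies. *)
Lemma finsler_quasiconvex x y (t : R) : 0 <= t <= 1 ->
  F p (t *: x + (1 - t) *: y) <= Num.max (F p x) (F p y).
Proof.
move=> t01; rewrite le_max.
have [[s [s01 /eqP s0]]|no0] :=
  pselect (exists s : R, 0 <= s <= 1 /\ s *: x + (1 - s) *: y == 0); last first.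
  have conv2 : f (t *: x + (1 - t) *: y) <= t * f x + (1 - t) * f y.
    apply: sqr_convex_segment => // s s01; apply/negP => s0; apply: no0.
    by exists s.
  rewrite -!(@ler_sqr _ (F p _)) ?nnegrE ?finsler_ge0 // -/(f x) -/(f y) -/(f _).
  by apply/orP; case: (leP (f x) (f y)) => xy; [right|left]; nra.
have [ts|st] := leP t s; apply/orP; [right|left].
  have [sE|sN0] := eqVneq s 0.
    by rewrite (_ : t = 0) ?scale0r ?subr0 ?scale1r ?add0r //; lra.
  have -> : t *: x + (1 - t) *: y = (1 - t / s) *: y.
    rewrite -[LHS]subr0 -[X in _ - X](scaler0 _ (t / s)) -s0 scalerDr !scalerA.
    rewrite divfK // opprD addrACA subrr add0r -scalerBl; congr (_ *: _).
    by field.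
  apply: shrink; rewrite subr_ge0 ler_pdivrMr ?mul1r ?ts; last by lra.
  by rewrite gerBl divr_ge0; lra.
have -> : t *: x + (1 - t) *: y = ((t - s) / (1 - s)) *: x.
  rewrite -[LHS]subr0 -[X in _ - X](scaler0 _ ((1 - t) / (1 - s))) -s0 scalerDr.
  rewrite !scalerA divfK; last by lra.
  rewrite opprD addrACA subrr addr0 -scalerBl; congr (_ *: _).
  by field; lra.
by apply: shrink; rewrite divr_ge0 ?ler_pdivrMr; lra.
Qed.

Lemma convex_finsler_ball e : convex_set (finsler_ball F e p).
Proof.
apply/convex_setP => x y t; rewrite /finsler_ball /= => xe ye t01.
have -> : t *: x + (1 - t) *: y - p = t *: (x - p) + (1 - t) *: (y - p).
  by rewrite !scalerBr addrACA -opprD -scalerDl subrKC scale1r.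
by apply: le_trans (finsler_quasiconvex _ _ t01) _; rewrite ge_max xe ye.
Qed.

End Ball.

Theorem corollary3p1 (R : realType) (n : nat) (n_ge1 : (1 <= n)%N)
    (X : {fset 'rV[R]_n}) (F : finsler R n) (K : fieldType) :
  (forall (e : {posnum R}) (k : nat), (n < k)%N ->
     lmod_trivial (homology K (cech_filtration F X e) k)) /\
  (forall k : nat, (n < k)%N ->
     pm_trivial (persistent_homology K (cech_filtration F X) k)).
Proof.
have van (e : {posnum R}) k : (n < k)%N ->
    lmod_trivial (homology K (cech_filtration F X e) k).
  move=> nk; apply: homology_trivial.
  (* The simplices of the complex are by definition those of the nerve. *)
  apply: (convex_nerve_vanishing (B := fun p : X => finsler_ball F e%:num (val p))
    _ _ nk) => p; exact: convex_finsler_ball.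
by split=> // k nk e; apply: van.
Qed.
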